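(* Let $D$ be a real $m\times p$ matrix. Suppose (a) that $S\subseteq\mathbb{R}^m$ is closed and convex, (b) that the loss $f:\mathbb{R}^p\to\mathbb{R}$ is convex and differentiable, and (c) that the constrained problem of minimizing $f(x)$ subject to $Dx\in S$ possesses a unique minimum point. Then for all sufficiently large $\rho>0$ the following holds. Let $z_\rho$ denote a minimal point of $$h_\rho(x)=f(x)+\frac{\rho}{2}\operatorname{dist}(Dx,S)^2 ,$$ let $x_0\in\mathbb{R}^p$, and let $(x_n)_{n\ge 0}$ be MM iterates, that is, $$x_{n+1}\in\operatorname{argmin}_{x\in\mathbb{R}^p}\ g_\rho(x\mid x_n),\qquad g_\rho(x\mid x_n)=f(x)+\frac{\rho}{2}\|Dx-\mathcal{P}(Dx_n)\|^2 .$$ Then for all $n\ge 0$ $$0\ \le\ h_\rho(x_{n+1})-h_\rho(z_\rho)\ \le\ \frac{\rho}{2(n+1)}\|D(z_\rho-x_0)\|^2 .$$ Furthermore, the iterate values $h_\rho(x_n)$ systematically decrease: $h_\rho(x_{n+1})\le h_\rho(x_n)$ for all $n\ge 0$.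
   Context: $\mathcal{P}(z)$ denotes the Euclidean projection of $z\in\mathbb{R}^m$ onto $S$ and $\operatorname{dist}(z,S)=\|z-\mathcal{P}(z)\|$ the Euclidean distance to $S$. *)

(* Defs.v *)
From HB Require Import structures.
From mathcomp Require Import all_boot all_order all_algebra.
From mathcomp Require Import all_classical all_reals all_analysis.

Set Implicit Arguments.
Unset Strict Implicit.
Unset Printing Implicit Defensive.

Import Order.TTheory GRing.Theory Num.Theory.
Import numFieldNormedType.Exports.

Local Open Scope classical_set_scope.
Local Open Scope ring_scope.

Definition argmin (R : realType) (T : Type) (A : set T) (F : T -> R) : set T :=
  [set x | A x /\ forall y, A y -> F x <= F y].

(* The library's norm `|x| on matrices is the sup norm, hence a separate
   Euclidean norm; both induce the same topology, which is the one meant by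
   [closed] and [differentiable]. *)
Definition enorm (R : realType) (m : nat) (x : 'cV[R]_m) : R :=
  Num.sqrt (\sum_i x i 0 ^+ 2).

(* A nearest point of S to z; it exists and is unique when S is nonempty,
   closed and convex.  The default value 0 is used only if there is none. *)
Definition eproj (R : realType) (m : nat) (S : set 'cV[R]_m) (z : 'cV[R]_m) :
    'cV[R]_m :=
  xget 0 (argmin S (fun w => enorm (z - w))).

Definition edist (R : realType) (m : nat) (z : 'cV[R]_m) (S : set 'cV[R]_m) : R :=
  enorm (z - eproj S z).

Definition penalized (R : realType) (m p : nat) (f : 'cV[R]_p -> R)
    (D : 'M[R]_(m, p)) (S : set 'cV[R]_m) (rho : R) (x : 'cV[R]_p) : R :=
  f x + rho / 2 * edist (D *m x) S ^+ 2.

(* g_rho(x | y), with y the point of majorization. *)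
Definition surrogate (R : realType) (m p : nat) (f : 'cV[R]_p -> R)
    (D : 'M[R]_(m, p)) (S : set 'cV[R]_m) (rho : R) (y x : 'cV[R]_p) : R :=
  f x + rho / 2 * enorm (D *m x - eproj S (D *m y)) ^+ 2.

Definition mm_iterates (R : realType) (m p : nat) (f : 'cV[R]_p -> R)
    (D : 'M[R]_(m, p)) (S : set 'cV[R]_m) (rho : R) (x : nat -> 'cV[R]_p) : Prop :=
  forall n, argmin setT (surrogate f D S rho (x n)) (x n.+1).

(* Main.v *)
Require Import Defs.
From HB Require Import structures.
From mathcomp Require Import all_boot all_order all_algebra.
From mathcomp Require Import all_classical all_reals all_analysis.
From mathcomp Require Import ring lra.

Set Implicit Arguments.
Unset Strict Implicit.
Unset Printing Implicit Defensive.

Import Order.TTheory GRing.Theory Num.Theory.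
Import numFieldNormedType.Exports.

Local Open Scope classical_set_scope.
Local Open Scope ring_scope.

(* Existence of minimizers for large rho.  On the unit sphere around the unique
   constrained minimizer y, the functions h_n increase with n and each point x
   has f y < h_n x for some n; by compactness one n works for the whole sphere,
   with a uniform gap c.  Convexity then gives h_rho x >= f y + c |x - y| outside
   the unit ball for all rho >= n, and every surrogate dominates h_rho.

   Rate.  As g_rho(. | x_n) - (rho/2) |D .|^2 is convex, its minimizer x_{n+1}
   satisfies g_rho(z | x_n) >= g_rho(x_{n+1} | x_n) + (rho/2) |D(z - x_{n+1})|^2,
   while |u - P v|^2 <= dist(u, S)^2 + |u - v|^2.  Hence
     h_rho(x_{n+1}) - h_rho(z) <= (rho/2) (|D(z - x_n)|^2 - |D(z - x_{n+1})|^2).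
   Taking z = x_n gives the descent property; telescoping gives the rate. *)

(** * Topology of column vectors: continuity, compactness, attained minima *)

(** Balls of the sup norm are entrywise conditions, and finitely many neighborhoods intersect in a
    neighborhood. *)
Lemma mx_continuous (R : realType) (T : topologicalType) (m n : nat)
    (F : T -> 'M[R]_(m, n)) :
  (forall i j, continuous (fun t => F t i j)) -> continuous F.
Proof.
move=> Fc t; apply/cvg_ballP => e e0.
have : \forall s \near t, forall i j, ball (F t i j) e (F s i j).
  apply: filter_forall => i; apply: filter_forall => j.
  by have /cvg_ballP := Fc i j t; exact.
by apply: filterS => s Fs; split.
Qed.

Lemma mulmx_continuous (R : realType) (m p : nat) (D : 'M[R]_(m, p)) :
  continuous (fun x : 'cV[R]_p => D *m x).
Proof.
apply: mx_continuous => i j.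
rewrite (_ : (fun x : 'cV[R]_p => _) = fun x => \sum_k D i k * x k j); last first.
  by apply/funext => x; rewrite mxE.
apply: continuous_big => [|k _]; first exact: add_continuous.
move=> x; apply: (@continuousM _ _ (fun=> D i k)); first exact: cst_continuous.
exact: coord_continuous.
Qed.

Lemma coord_le_norm (R : realType) (m n : nat) (x : 'M[R]_(m, n)) i j :
  `|x i j| <= `|x|.
Proof.
rewrite [leRHS]/Num.norm /= mx_normrE.
by have /bigmax_leP[_ /(_ (i, j))] := lexx (\big[Num.max/0]_ij `|x ij.1 ij.2|); exact.
Qed.

Lemma norm_le_coord (R : realType) (m n : nat) (x : 'M[R]_(m, n)) (M : R) :
  0 <= M -> (forall i j, `|x i j| <= M) -> `|x| <= M.
Proof.
move=> M0 xM; rewrite [leLHS]/Num.norm /= mx_normrE.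
by apply/bigmax_leP; split => // -[i j] _ /=.
Qed.

(** Transposition carries the claim to row vectors, where [bounded_closed_compact] applies. *)
Lemma cV_bounded_closed_compact (R : realType) (n : nat) (A : set 'cV[R]_n)
    (M : R) :
  (forall x, A x -> `|x| <= M) -> closed A -> compact A.
Proof.
move=> AM Acl.
have trc k l : continuous (@trmx R k l).
  apply: mx_continuous => i j.
  rewrite (_ : (fun t => _) = (fun x : 'M[R]_(k, l) => x j i)).
    exact: coord_continuous.
  by apply/funext => x; rewrite mxE.
pose B := [set v : 'rV[R]_n | A v^T].
rewrite (_ : A = trmx @` B); last first.
  apply/seteqP; split => [x Ax|_ [v Bv <-]//].
  by exists x^T; rewrite /B/= trmxK.
apply: continuous_compact; first exact: (continuous_subspaceT (trc 1 n)).
apply: bounded_closed_compact; last first.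
  by apply: (preimage_closed _ Acl) => x _; exact: trc.
exists M; split; first exact: num_real.
move=> N MN v Bv; apply: norm_le_coord => [|i j].
  by rewrite (le_trans (normr_ge0 v^T))// (le_trans (AM _ Bv))// ltW.
have -> : v i j = v^T j i by rewrite mxE.
by apply: le_trans (coord_le_norm v^T j i) _; rewrite (le_trans (AM _ Bv))// ltW.
Qed.

Lemma ball_compact (R : realType) (n : nat) (A : set 'cV[R]_n) (y : 'cV[R]_n)
    (r : R) :
  closed A -> (forall x, A x -> `|x - y| <= r) -> compact A.
Proof.
move=> Acl Ar; apply: (@cV_bounded_closed_compact _ _ _ (r + `|y|)) => // x /Ar xr.
by rewrite -[x](subrK y) (le_trans (ler_normD _ _))// lerD2r.
Qed.

Lemma distl_continuous (R : realType) (n : nat) (y : 'cV[R]_n) :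
  continuous (fun x : 'cV[R]_n => `|x - y|).
Proof.
have shift : continuous (fun x : 'cV[R]_n => x - y).
  move=> x; apply: (@continuousB _ _ _ id (fun=> y) x (fun t => id)).
  exact: cst_continuous.
have norm : continuous (fun x : 'cV[R]_n => `|x|) by exact: norm_continuous.
move=> x; exact: (continuous_comp (shift x) (norm (x - y))).
Qed.

(** Linear growth away from [y] confines the search to a closed ball, on which the extreme value
    theorem applies. *)
Lemma coercive_argmin (R : realType) (n : nat) (A : set 'cV[R]_n)
    (F : 'cV[R]_n -> R) (y : 'cV[R]_n) (a c : R) :
  closed A -> A !=set0 -> continuous F -> 0 < c ->
  (forall x, 1 <= `|x - y| -> a + c * `|x - y| <= F x) ->
  exists x, argmin A F x.
Proof.
move=> Acl [x0 Ax0] Fc c0 Fge.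
(* Beyond radius [M] the growth bound applies (the 1) and exceeds [F x0] (the quotient); the last
   summand keeps [x0] inside the ball. *)
pose M := Num.max 1 ((F x0 - a) / c) + `|x0 - y|.
pose K := A `&` [set x | `|x - y| <= M].
have M1 : 1 <= Num.max 1 ((F x0 - a) / c) by rewrite le_max lexx.
have M2 : (F x0 - a) / c <= Num.max 1 ((F x0 - a) / c) by rewrite le_max lexx orbT.
have Kx0 : K x0 by split => //=; rewrite /M lerDr; lra.
have Kc : compact K.
  apply: (@ball_compact _ _ _ y M) => [|x []//]; apply: closedI => //.
  have := @preimage_closed _ _ (fun x : 'cV[R]_n => `|x - y|) _ _ (@closed_le _ M).
  by apply=> x _; exact: distl_continuous.
have [||x Kx xmin] := @compact_EVT_min _ _ F K _ Kc; first by exists x0.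
  exact: continuous_subspaceT.
exists x; split => [|z Az]; first by move: Kx; rewrite inE => -[].
have [zM|Mz] := leP `|z - y| M; first by apply: xmin; rewrite inE.
have n0 := normr_ge0 (x0 - y).
apply: le_trans (xmin x0 _) _; first by rewrite inE.
apply: le_trans (Fge z _); last by rewrite /M in Mz; lra.
rewrite -lerBlDl mulrC -ler_pdivrMr//.
by rewrite /M in Mz; lra.
Qed.

(** A Dini-type argument: if each [n] failed at some point [x n], a cluster point of these would
    contradict monotonicity in [n]. Tying the gap to the index leaves a single natural number to
    find. *)
Lemma compact_uniform_lt (R : realType) (T : topologicalType) (K : set T)
    (h : nat -> T -> R) (a : R) :
  compact K -> (forall n, continuous (h n)) ->
  (forall m n x, (m <= n)%N -> h m x <= h n x) ->
  (forall x, K x -> exists n, a < h n x) ->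
  exists n, forall x, K x -> a + n.+1%:R^-1 <= h n x.
Proof.
move=> Kc hc hmono hK; apply: contrapT => noN.
have {noN} xP n : exists x, K x /\ h n x < a + n.+1%:R^-1.
  apply: contrapT => nox; apply: noN; exists n => x Kx.
  by rewrite leNgt; apply/negP => hx; apply: nox; exists x.
pose x n := sval (cid (xP n)).
have xK n : K (x n) by rewrite /x; case: cid => ? [].
have xh n : h n (x n) < a + n.+1%:R^-1 by rewrite /x; case: cid => ? [].
have [] := Kc (x @ \oo) _; first by exists 0%N => // n _ /=; exact: xK.
move=> z [Kz zx].
have [n an] := hK z Kz.
(* [N] serves twice: it is past [n], for monotonicity, and its gap fits below [h n z - a]. *)
have [N [nN aN]] : exists N, (n <= N)%N /\ a + N.+1%:R^-1 < h n z.
  pose k := Num.bound ((h n z - a)^-1).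
  exists (maxn n k); split; first exact: leq_maxl.
  have hk : (h n z - a)^-1 < (maxn n k).+1%:R.
    apply: (lt_le_trans (archi_boundP _)); first by rewrite invr_ge0; lra.
    by rewrite ler_nat ltnW// ltnS leq_maxr.
  rewrite -ltrBrDl -[ltRHS]invrK ltf_pV2// posrE ?ltr0n// invr_gt0; lra.
(* Clustering at [z]: some [x k] with [k >= N] lies in the neighborhood where [h n] stays above
   [a + N.+1%:R^-1]. *)
have [_ [[k Nk <-] /= hlt]] :
    [set x k | k in [set k | (N <= k)%N]] `&` [set t | a + N.+1%:R^-1 < h n t] !=set0.
  apply: zx; first by exists N => // k /= Nk; exists k.
  exact: (cvgr_gt _ (hc n z)).
have := xh k; rewrite ltNge => /negP; apply.
apply: (@le_trans _ _ (a + N.+1%:R^-1)).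
  by rewrite lerD2l lef_pV2 ?posrE ?ltr0n// ler_nat ltnS.
by apply: (le_trans (ltW hlt)); apply: hmono; exact: leq_trans Nk.
Qed.

(** * The Euclidean inner product *)

(** Squared Euclidean norms are handled as [dot x x], so that bilinear expansion replaces square
    roots. *)
Definition dot (R : realType) (n : nat) (x y : 'cV[R]_n) : R :=
  \sum_i x i 0 * y i 0.

Lemma enorm_sqr (R : realType) (n : nat) (x : 'cV[R]_n) :
  enorm x ^+ 2 = dot x x.
Proof.
rewrite /enorm sqr_sqrtr; last by apply: sumr_ge0 => i _; exact: sqr_ge0.
by apply: eq_bigr => i _; rewrite expr2.
Qed.

Lemma dot_ge0 (R : realType) (n : nat) (x : 'cV[R]_n) : 0 <= dot x x.
Proof. by rewrite -enorm_sqr sqr_ge0. Qed.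

Lemma dotC (R : realType) (n : nat) (x y : 'cV[R]_n) : dot x y = dot y x.
Proof. by apply: eq_bigr => i _; rewrite mulrC. Qed.

Lemma dotDl (R : realType) (n : nat) (x y z : 'cV[R]_n) :
  dot (x + y) z = dot x z + dot y z.
Proof. by rewrite /dot -big_split /=; apply: eq_bigr => i _; rewrite mxE mulrDl. Qed.

Lemma dotZl (R : realType) (n : nat) (a : R) (x y : 'cV[R]_n) :
  dot (a *: x) y = a * dot x y.
Proof. by rewrite /dot mulr_sumr; apply: eq_bigr => i _; rewrite mxE mulrA. Qed.

Lemma dotDr (R : realType) (n : nat) (x y z : 'cV[R]_n) :
  dot z (x + y) = dot z x + dot z y.
Proof. by rewrite dotC dotDl !(dotC z). Qed.

Lemma dotZr (R : realType) (n : nat) (a : R) (x y : 'cV[R]_n) :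
  dot x (a *: y) = a * dot x y.
Proof. by rewrite dotC dotZl dotC. Qed.

Lemma dotNl (R : realType) (n : nat) (x y : 'cV[R]_n) : dot (- x) y = - dot x y.
Proof. by rewrite -scaleN1r dotZl mulN1r. Qed.

Lemma dotNr (R : realType) (n : nat) (x y : 'cV[R]_n) : dot x (- y) = - dot x y.
Proof. by rewrite dotC dotNl dotC. Qed.

Definition dotE := (dotDl, dotDr, dotZl, dotZr, dotNl, dotNr).

(** This is the strong convexity identity of the squared norm; its subtracted term produces the
    quadratic gap at surrogate minimizers. *)
Lemma dot_conv (R : realType) (n : nat) (t : R) (x y : 'cV[R]_n) :
  dot (t *: x + (1 - t) *: y) (t *: x + (1 - t) *: y) =
  t * dot x x + (1 - t) * dot y y - t * (1 - t) * dot (x - y) (x - y).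
Proof. by rewrite !dotE (dotC y x); ring. Qed.

Lemma dot_continuous (R : realType) (n : nat) (a : 'cV[R]_n) :
  continuous (fun x : 'cV[R]_n => dot (x - a) (x - a)).
Proof.
have c i : continuous (fun x : 'cV[R]_n => (x - a) i 0).
  rewrite (_ : (fun x : 'cV[R]_n => _) = fun x => x i 0 - a i 0); last first.
    by apply/funext => x; rewrite !mxE.
  move=> x; apply: (@continuousB _ _ _ _ (fun=> a i 0)); last exact: cst_continuous.
  exact: coord_continuous.
apply: continuous_big => [|i _]; first exact: add_continuous.
by move=> x; exact: (continuousM (c i x) (c i x)).
Qed.

(** Each squared entry is one summand of the squared Euclidean norm. This links the sup norm of the
    topology to [dot]. *)
Lemma sqr_norm_le_dot (R : realType) (n : nat) (x : 'cV[R]_n) :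
  `|x| ^+ 2 <= dot x x.
Proof.
rewrite -enorm_sqr ler_sqr ?nnegrE ?sqrtr_ge0//.
apply: norm_le_coord => [|i j]; first exact: sqrtr_ge0.
rewrite ord1 -sqrtr_sqr ler_sqrt; last first.
  by apply: sumr_ge0 => k _; exact: sqr_ge0.
by rewrite (bigD1 i)//= lerDl; apply: sumr_ge0 => k _; exact: sqr_ge0.
Qed.

(** The limit [t -> 0] in algebraic form, used to extract first-order conditions from comparisons
    along segments. *)
Lemma le0_of_le_small (R : realType) (a b : R) :
  (forall t, 0 < t -> t <= 1 -> a <= t * b) -> a <= 0.
Proof.
move=> ab; rewrite leNgt; apply/negP => a0.
have b0 : a <= b by rewrite -[b]mul1r; apply: ab.
have b1 : 0 < b by exact: lt_le_trans b0.
(* This [t] turns the bound into [a <= a / 2]; it is at most 1 because [a <= b]. *)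
have : a <= a / (2 * b) * b.
  apply: ab; first by rewrite divr_gt0// mulr_gt0.
  by rewrite ler_pdivrMr ?mulr_gt0//; lra.
rewrite invfM mulrA mulfVK ?gt_eqF//; lra.
Qed.

(** * Projection onto a closed convex set and the squared distance *)

(** The squared distance to [z] is continuous and dominates [|w - z|] once that is at least 1, so a
    minimum on [S] is attained and the default of [eproj] never occurs here. *)
Lemma eproj_argmin (R : realType) (m : nat) (S : set 'cV[R]_m) (z : 'cV[R]_m) :
  closed S -> S !=set0 -> argmin S (fun w => enorm (z - w)) (eproj S z).
Proof.
move=> Scl S0; apply: xgetPex.
have [||x w1|x [Sx xmin]] :=
    @coercive_argmin _ _ S (fun w => dot (w - z) (w - z)) z 0 1 Scl S0.
- exact: dot_continuous.
- exact: ltr01.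
- apply: le_trans (sqr_norm_le_dot _); rewrite add0r mul1r expr2.
  by rewrite ler_peMl// (le_trans ler01).
exists x; split => // w Sw.
rewrite -ler_sqr ?nnegrE ?sqrtr_ge0// !enorm_sqr.
by have := xmin w Sw; rewrite -(opprB z x) -(opprB z w) !(dotNl, dotNr) !opprK.
Qed.

Lemma eproj_in (R : realType) (m : nat) (S : set 'cV[R]_m) (z : 'cV[R]_m) :
  closed S -> S !=set0 -> S (eproj S z).
Proof. by move=> Scl S0; have [] := eproj_argmin z Scl S0. Qed.

Lemma edist_sqr_le (R : realType) (m : nat) (S : set 'cV[R]_m) (z w : 'cV[R]_m) :
  closed S -> S !=set0 -> S w -> Defs.edist z S ^+ 2 <= dot (z - w) (z - w).
Proof.
move=> Scl S0 Sw; rewrite -enorm_sqr ler_sqr ?nnegrE ?sqrtr_ge0//.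
by have [_] := eproj_argmin z Scl S0; exact.
Qed.

Lemma convex_setP (R : realType) (m : nat) (S : set 'cV[R]_m) (t : R)
    (x y : 'cV[R]_m) :
  @convex_set R 'cV[R]_m S -> 0 <= t -> t <= 1 -> S x -> S y ->
  S (t *: x + (1 - t) *: y).
Proof.
move=> Sconv t0 t1 Sx Sy.
by have := Sconv x y (Itv01 t0 t1); rewrite !inE; exact.
Qed.

Lemma convex_functionP (R : realType) (p : nat) (f : 'cV[R]_p -> R) (t : R)
    (x y : 'cV[R]_p) :
  @convex_function R 'cV[R]_p setT f -> 0 <= t -> t <= 1 ->
  f (t *: x + (1 - t) *: y) <= t * f x + (1 - t) * f y.
Proof.
by move=> fconv t0 t1; apply: (fconv (Itv01 t0 t1)); rewrite inE.
Qed.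

(** Moving from the projection [P] towards [w] by a fraction [t] stays in [S] and cannot reduce the
    distance, so [2 <z - P, w - P> <= t |w - P|^2]; then [t] tends to 0. *)
Lemma eproj_obtuse (R : realType) (m : nat) (S : set 'cV[R]_m) (z w : 'cV[R]_m) :
  closed S -> @convex_set R 'cV[R]_m S -> S w ->
  dot (z - eproj S z) (w - eproj S z) <= 0.
Proof.
move=> Scl Sconv Sw; have S0 : S !=set0 by exists w.
have SP := eproj_in z Scl S0.
set P := eproj S z in SP *.
apply: (@le0_of_le_small _ _ (dot (w - P) (w - P) / 2)) => t t0 t1.
have := edist_sqr_le z Scl S0 (convex_setP Sconv (ltW t0) t1 Sw SP).
rewrite /Defs.edist enorm_sqr -/P.
have -> : z - (t *: w + (1 - t) *: P) = (z - P) - t *: (w - P).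
  by apply/matrixP => i j; rewrite !mxE; ring.
rewrite [dot (_ - t *: _) _](_ : _ = dot (z - P) (z - P)
  - t * (2 * dot (z - P) (w - P) - t * dot (w - P) (w - P))); last first.
  move: (z - P) (w - P) => u v; rewrite !dotE (dotC v u); ring.
rewrite lerBrDr gerDl pmulr_rle0// => h; lra.
Qed.

(* With [a], [b] the projections of [v], [u]: obtuseness gives
   [2 <u - b, b - a> + |b - a|^2 <= 2 <u - v, b - a> - |b - a|^2 <= |u - v|^2]. *)
Lemma eproj_majorization (R : realType) (m : nat) (S : set 'cV[R]_m)
    (u v : 'cV[R]_m) :
  closed S -> S !=set0 -> @convex_set R 'cV[R]_m S ->
  dot (u - eproj S v) (u - eproj S v) <= Defs.edist u S ^+ 2 + dot (u - v) (u - v).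
Proof.
move=> Scl S0 Sconv; rewrite /Defs.edist enorm_sqr.
have := eproj_obtuse v Scl Sconv (eproj_in u Scl S0).
set a := eproj S v; set b := eproj S u => ob.
have := dot_ge0 (u - v - (b - a)).
have <- : (u - v) + (v - a) - (b - a) = u - b.
  by apply/matrixP => i j; rewrite !mxE; ring.
have <- : (u - v) + (v - a) = u - a.
  by apply/matrixP => i j; rewrite !mxE; ring.
move: (u - v) (v - a) (b - a) ob => e q d.
rewrite !dotE (dotC d e) (dotC d q) (dotC q e); lra.
Qed.

(** Near [v] the squared distance of [u] is squeezed between [|u - P v|^2 - |u - v|^2] and
    [|u - P v|^2], which agree at [u = v]. *)
Lemma edist_sqr_continuous (R : realType) (m : nat) (S : set 'cV[R]_m) :
  closed S -> S !=set0 -> @convex_set R 'cV[R]_m S ->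
  continuous (fun z : 'cV[R]_m => Defs.edist z S ^+ 2).
Proof.
move=> Scl S0 Sconv v.
have lim0 : dot (v - v) (v - v) = 0 by rewrite subrr -(scale0r 0) dotZl mul0r.
apply: (@squeeze_cvgr _ (nbhs v) (@nbhs_filter _ v) _
  (fun u => dot (u - eproj S v) (u - eproj S v) - dot (u - v) (u - v))
  (fun u => dot (u - eproj S v) (u - eproj S v))).
- apply: nearW => u; rewrite lerBlDr eproj_majorization//=.
  by apply: edist_sqr_le => //; exact: eproj_in.
- rewrite [X in _ --> X](_ : _ =
    dot (v - eproj S v) (v - eproj S v) - dot (v - v) (v - v)); last first.
    by rewrite lim0 subr0 /Defs.edist enorm_sqr.
  exact: (continuousB (@dot_continuous _ _ (eproj S v) v) (@dot_continuous _ _ v v)).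
- by rewrite /Defs.edist enorm_sqr; exact: dot_continuous.
Qed.

(** The convex combination of the two projections lies in [S] and serves as competitor; [dot_conv]
    then bounds its squared distance. *)
Lemma edist_sqr_convex (R : realType) (m : nat) (S : set 'cV[R]_m) (t : R)
    (u v : 'cV[R]_m) :
  closed S -> S !=set0 -> @convex_set R 'cV[R]_m S -> 0 <= t -> t <= 1 ->
  Defs.edist (t *: u + (1 - t) *: v) S ^+ 2 <=
  t * Defs.edist u S ^+ 2 + (1 - t) * Defs.edist v S ^+ 2.
Proof.
move=> Scl S0 Sconv t0 t1.
apply: le_trans (edist_sqr_le _ Scl S0
  (convex_setP Sconv t0 t1 (eproj_in u Scl S0) (eproj_in v Scl S0))) _.
rewrite /Defs.edist !enorm_sqr opprD addrACA -!scalerBr dot_conv gerDl oppr_le0.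
by rewrite mulr_ge0 ?dot_ge0// mulr_ge0// subr_ge0.
Qed.

Lemma edist_eq0 (R : realType) (m : nat) (S : set 'cV[R]_m) (z : 'cV[R]_m) :
  closed S -> S !=set0 -> Defs.edist z S ^+ 2 <= 0 -> S z.
Proof.
move=> Scl S0 d0.
suff -> : z = eproj S z by exact: eproj_in.
apply/eqP; rewrite -subr_eq0 -normr_eq0 -sqrf_eq0 eq_le sqr_ge0 andbT.
by apply: le_trans (sqr_norm_le_dot _) _; rewrite -enorm_sqr.
Qed.

Lemma edist_in (R : realType) (m : nat) (S : set 'cV[R]_m) (z : 'cV[R]_m) :
  closed S -> S z -> Defs.edist z S ^+ 2 = 0.
Proof.
move=> Scl Sz; have S0 : S !=set0 by exists z.
apply/eqP; rewrite eq_le sqr_ge0 andbT.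
by apply: le_trans (edist_sqr_le z Scl S0 Sz) _; rewrite subrr -(scale0r 0) dotZl mul0r.
Qed.

(** * Continuity, convexity and majorization for the penalized objective and its surrogate *)

Lemma penalized_continuous (R : realType) (m p : nat) (f : 'cV[R]_p -> R)
    (D : 'M[R]_(m, p)) (S : set 'cV[R]_m) (rho : R) :
  closed S -> S !=set0 -> @convex_set R 'cV[R]_m S -> continuous f ->
  continuous (penalized f D S rho).
Proof.
move=> Scl S0 Sconv fc x.
have dc := continuous_comp (@mulmx_continuous _ _ _ D x)
  (@edist_sqr_continuous _ _ _ Scl S0 Sconv (D *m x)).
exact: (continuousD (fc x) (continuousM (@cst_continuous _ _ (rho / 2) x) dc)).
Qed.

Lemma surrogate_continuous (R : realType) (m p : nat) (f : 'cV[R]_p -> R)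
    (D : 'M[R]_(m, p)) (S : set 'cV[R]_m) (rho : R) (y : 'cV[R]_p) :
  continuous f -> continuous (surrogate f D S rho y).
Proof.
move=> fc x.
have dc := continuous_comp (@mulmx_continuous _ _ _ D x)
  (@dot_continuous _ _ (eproj S (D *m y)) (D *m x)).
rewrite (_ : surrogate f D S rho y = fun x => f x + rho / 2 *
    dot (D *m x - eproj S (D *m y)) (D *m x - eproj S (D *m y))); last first.
  by apply/funext => z; rewrite /surrogate enorm_sqr.
exact: (continuousD (fc x) (continuousM (@cst_continuous _ _ (rho / 2) x) dc)).
Qed.

Lemma penalized_convex (R : realType) (m p : nat) (f : 'cV[R]_p -> R)
    (D : 'M[R]_(m, p)) (S : set 'cV[R]_m) (rho t : R) (x y : 'cV[R]_p) :
  closed S -> S !=set0 -> @convex_set R 'cV[R]_m S ->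
  @convex_function R 'cV[R]_p setT f -> 0 <= rho -> 0 <= t -> t <= 1 ->
  penalized f D S rho (t *: x + (1 - t) *: y) <=
  t * penalized f D S rho x + (1 - t) * penalized f D S rho y.
Proof.
move=> Scl S0 Sconv fconv rho0 t0 t1; rewrite /penalized.
have f1 := convex_functionP x y fconv t0 t1.
have := edist_sqr_convex (D *m x) (D *m y) Scl S0 Sconv t0 t1.
rewrite mulmxDr -!scalemxAr.
have r2 : 0 <= rho / 2 by lra.
have distr (a b c d : R) : t * a + (1 - t) * b + rho / 2 * (t * c + (1 - t) * d) =
  t * (a + rho / 2 * c) + (1 - t) * (b + rho / 2 * d) by ring.
by move=> /(ler_wpM2l r2) /(lerD f1) /le_trans; apply; rewrite distr.
Qed.

Lemma penalized_le_surrogate (R : realType) (m p : nat) (f : 'cV[R]_p -> R)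
    (D : 'M[R]_(m, p)) (S : set 'cV[R]_m) (rho : R) (y x : 'cV[R]_p) :
  closed S -> S !=set0 -> 0 <= rho ->
  penalized f D S rho x <= surrogate f D S rho y x.
Proof.
move=> Scl S0 rho0.
have := edist_sqr_le (D *m x) Scl S0 (eproj_in (D *m y) Scl S0).
by rewrite -enorm_sqr => le_d; rewrite lerD2l; apply: ler_wpM2l; rewrite ?divr_ge0.
Qed.

(** * The MM inequality and its telescoping *)

(** The minimizer [x] is compared with [t *: z + (1 - t) *: x]; the exact quadratic term from
    [dot_conv] survives division by [t] and the limit [t -> 0]. *)
Lemma surrogate_min_gap (R : realType) (m p : nat) (f : 'cV[R]_p -> R)
    (D : 'M[R]_(m, p)) (S : set 'cV[R]_m) (rho : R) (y x z : 'cV[R]_p) :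
  @convex_function R 'cV[R]_p setT f ->
  argmin setT (surrogate f D S rho y) x ->
  surrogate f D S rho y x + rho / 2 * dot (D *m (z - x)) (D *m (z - x)) <=
  surrogate f D S rho y z.
Proof.
move=> fconv [_ xmin]; rewrite -subr_le0.
apply: (@le0_of_le_small _ _ (rho / 2 * dot (D *m (z - x)) (D *m (z - x)))).
move=> t t0 t1.
have := xmin (t *: z + (1 - t) *: x) I.
have := convex_functionP z x fconv (ltW t0) t1.
rewrite /surrogate !enorm_sqr mulmxDr -!scalemxAr mulmxBr.
set P := eproj S _.
rewrite (_ : _ + _ - P = t *: (D *m z - P) + (1 - t) *: (D *m x - P)); last first.
  by apply/matrixP => i j; rewrite !mxE; ring.
rewrite dot_conv (_ : D *m z - P - (D *m x - P) = D *m z - D *m x); last first.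
  by rewrite opprB addrA subrK.
move: (f (_ + _)) (f z) (f x) (dot _ _) (dot (D *m z - P) _) (dot (D *m x - P) _).
move=> fc fz fx c a b f1 h.
rewrite -(ler_pM2l t0).
have {}h := le_trans h (lerD f1 (lexx _)); lra.
Qed.

(** The chain is [h x <= g(x | y) <= g(z | y) - (rho/2) |D(z - x)|^2], with
    [g(z | y) <= h z + (rho/2) |D(z - y)|^2] from [eproj_majorization]. The point [z] stays
    arbitrary to serve both rate and descent. *)
Lemma mm_step (R : realType) (m p : nat) (f : 'cV[R]_p -> R)
    (D : 'M[R]_(m, p)) (S : set 'cV[R]_m) (rho : R) (y x z : 'cV[R]_p) :
  closed S -> S !=set0 -> @convex_set R 'cV[R]_m S ->
  @convex_function R 'cV[R]_p setT f -> 0 <= rho ->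
  argmin setT (surrogate f D S rho y) x ->
  penalized f D S rho x - penalized f D S rho z <=
  rho / 2 * (dot (D *m (z - y)) (D *m (z - y)) - dot (D *m (z - x)) (D *m (z - x))).
Proof.
move=> Scl S0 Sconv fconv rho0 xmin.
have h1 := penalized_le_surrogate f D y x Scl S0 rho0.
have h2 := surrogate_min_gap z fconv xmin.
have r2 : 0 <= rho / 2 by lra.
have /(ler_wpM2l r2) := eproj_majorization (D *m z) (D *m y) Scl S0 Sconv.
rewrite -enorm_sqr -mulmxBr => h3.
have arith (r hx s fz c e d q : R) : hx <= s -> s + r * c <= fz + r * e ->
  r * e <= r * (d + q) -> hx - (fz + r * d) <= r * (q - c) by lra.
exact: arith h1 h2 h3.
Qed.

(** Summing the step inequalities bounds the sum of the gaps; by descent the latest gap is the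
    smallest, so it may replace each of them. *)
Lemma mm_telescope (R : realType) (m p : nat) (f : 'cV[R]_p -> R)
    (D : 'M[R]_(m, p)) (S : set 'cV[R]_m) (rho : R) (z : 'cV[R]_p)
    (x : nat -> 'cV[R]_p) (n : nat) :
  closed S -> S !=set0 -> @convex_set R 'cV[R]_m S ->
  @convex_function R 'cV[R]_p setT f -> 0 <= rho ->
  mm_iterates f D S rho x ->
  n.+1%:R * (penalized f D S rho (x n.+1) - penalized f D S rho z) <=
  rho / 2 * (dot (D *m (z - x 0%N)) (D *m (z - x 0%N)) -
             dot (D *m (z - x n.+1)) (D *m (z - x n.+1))).
Proof.
move=> Scl S0 Sconv fconv rho0 xmm.
have step k w := mm_step w Scl S0 Sconv fconv rho0 (xmm k).
have r2 : 0 <= rho / 2 by exact: divr_ge0.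
have arith (N a b c q u v r : R) : N * a <= N * b -> N * (b - c) <= r * (q - u) ->
  a - c <= r * (u - v) -> (N + 1) * (a - c) <= r * (q - v) by lra.
elim: n => [|n IHn]; first by rewrite mul1r.
(* With the preceding iterate as comparison point, the positive term of the step bound vanishes. *)
have dec : penalized f D S rho (x n.+2) <= penalized f D S rho (x n.+1).
  rewrite -subr_le0; apply: le_trans (step _ _) _; rewrite mulr_ge0_le0//.
  rewrite subrr mulmx0 -(scale0r 0) dotZl mul0r sub0r oppr_le0; exact: dot_ge0.
have n0 : 0 <= n.+1%:R :> R by [].
rewrite -[n.+2%:R]natr1.
exact: arith (ler_wpM2l n0 dec) IHn (step _ _).
Qed.

(** * Growth of the penalized objective for large [rho] *)

(** If [x] is feasible, uniqueness gives [f y < f x] and [n = 0] works; otherwise the distance is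
    positive and a large penalty outweighs [f y - f x]. *)
Lemma penalized_gt_eventually (R : realType) (m p : nat) (f : 'cV[R]_p -> R)
    (D : 'M[R]_(m, p)) (S : set 'cV[R]_m) (y x : 'cV[R]_p) :
  closed S -> S !=set0 ->
  unique (argmin [set x | S (D *m x)] f) y -> x != y ->
  exists n, f y < penalized f D S n%:R x.
Proof.
move=> Scl S0 [[Sy ymin] yuniq] xy.
have [d0|d0] := leP (Defs.edist (D *m x) S ^+ 2) 0.
  exists 0%N; rewrite /penalized mul0r mul0r addr0 ltNge; apply/negP => fxy.
  have Sx := edist_eq0 Scl S0 d0.
  move/eqP: xy; apply; apply/esym/yuniq; split => // z Sz.
  exact: le_trans fxy (ymin z Sz).
exists (Num.bound (2 * `|f y - f x| / Defs.edist (D *m x) S ^+ 2)).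
rewrite /penalized -ltrBlDl; apply: le_lt_trans (ler_norm _) _.
rewrite mulrAC ltr_pdivlMr// mulrC -ltr_pdivrMr//.
by apply: archi_boundP; exact: divr_ge0 (mulr_ge0 _ (normr_ge0 _)) (ltW d0).
Qed.

Lemma penalized_growth (R : realType) (m p : nat) (f : 'cV[R]_p -> R)
    (D : 'M[R]_(m, p)) (S : set 'cV[R]_m) (y : 'cV[R]_p) :
  closed S -> @convex_set R 'cV[R]_m S -> @convex_function R 'cV[R]_p setT f ->
  continuous f -> unique (argmin [set x | S (D *m x)] f) y ->
  exists n : nat, forall rho x, n%:R <= rho -> 1 <= `|x - y| ->
    f y + n.+1%:R^-1 * `|x - y| <= penalized f D S rho x.
Proof.
move=> Scl Sconv fconv fc yuniq.
have Sy : S (D *m y) by case: yuniq => -[].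
have S0 : S !=set0 by exists (D *m y).
have pen_mono (r s : R) x : r <= s -> penalized f D S r x <= penalized f D S s x.
  by move=> rs; rewrite lerD2l ler_wpM2r ?sqr_ge0// ler_pM2r.
pose K := [set x : 'cV[R]_p | `|x - y| = 1].
have Kc : compact K.
  apply: (@ball_compact _ _ _ y 1) => [|x ->//].
  have := @preimage_closed _ _ (fun x : 'cV[R]_p => `|x - y|) _ _ (@closed_eq _ 1).
  by apply=> x _; exact: distl_continuous.
have [|k l x kl|x Kx|n nP] :=
    @compact_uniform_lt _ _ K (fun k => penalized f D S k%:R) (f y) Kc.
- by move=> k; exact: penalized_continuous.
- by apply: pen_mono; rewrite ler_nat.
- apply: penalized_gt_eventually => //; apply/eqP => xy.
  by move: Kx; rewrite /K /= xy subrr normr0 => /eqP; rewrite eq_sym oner_eq0.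
exists n => rho x nrho x1; apply: le_trans (pen_mono _ _ _ nrho).
set r := `|x - y| in x1 *; have r0 : 0 < r by exact: lt_le_trans x1.
have t0 : 0 <= r^-1 by rewrite invr_ge0 ltW.
have t1 : r^-1 <= 1 by rewrite invf_le1.
(* The segment from [y] to [x] meets the unit sphere at parameter [r^-1]. *)
have Kw : K (r^-1 *: x + (1 - r^-1) *: y).
  rewrite /K /= (_ : _ - y = r^-1 *: (x - y)).
    by rewrite normrZ ger0_norm// mulVf// gt_eqF.
  by apply/matrixP => i j; rewrite !mxE; ring.
have n0 : 0 <= n%:R :> R by [].
have := le_trans (nP _ Kw) (penalized_convex D x y Scl S0 Sconv fconv n0 t0 t1).
(* The penalty vanishes at the feasible point [y], so the chord starts at height [f y]. *)
rewrite {2}/penalized (edist_in Scl Sy) mulr0 addr0.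
have arith (a h c : R) : a + c <= r^-1 * h + (1 - r^-1) * a -> a + c * r <= h.
  rewrite -(ler_pM2l r0) (_ : r * (_ * h + _) = h + (r - 1) * a).
    by move=> ?; lra.
  by field; rewrite gt_eqF.
exact: arith.
Qed.

(** * Existence of minimizers and iterates, rate and descent *)

Theorem proposition3p3 (R : realType) (m p : nat) (D : 'M[R]_(m, p))
    (S : set 'cV[R]_m) (f : 'cV[R]_p -> R)
    (S_closed : closed S)
    (S_convex : @convex_set R 'cV[R]_m S)
    (f_convex : @convex_function R 'cV[R]_p setT f)
    (f_diff : forall x : 'cV[R]_p, differentiable f x)
    (unique_min : exists! y, argmin [set x | S (D *m x)] f y) :
  exists2 rho0 : R, 0 < rho0 & forall rho : R, rho0 <= rho ->
    [/\ exists z, argmin setT (penalized f D S rho) z,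
        forall x0 : 'cV[R]_p, exists x : nat -> 'cV[R]_p,
          x 0%N = x0 /\ mm_iterates f D S rho x
      & forall (z : 'cV[R]_p) (x : nat -> 'cV[R]_p),
          argmin setT (penalized f D S rho) z ->
          mm_iterates f D S rho x ->
          (forall n : nat,
             0 <= penalized f D S rho (x n.+1) - penalized f D S rho z
               <= rho / (2 * n.+1%:R) * enorm (D *m (z - x 0%N)) ^+ 2) /\
          (forall n : nat,
             penalized f D S rho (x n.+1) <= penalized f D S rho (x n))].
Proof.
have fc : continuous f by move=> x; exact: (differentiable_continuous (f_diff x)).
have [y yuniq] := unique_min.
have S0 : S !=set0 by exists (D *m y); case: yuniq => -[].
have [N growth] := penalized_growth S_closed S_convex f_convex fc yuniq.
(* The successor keeps the threshold positive even when [N = 0]. *)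
exists N.+1%:R => [|rho Nrho]; first by rewrite ltr0n.
have rho0 : 0 <= rho by exact: le_trans (ler0n _ _) Nrho.
have {Nrho} Nrho : N%:R <= rho by apply: le_trans Nrho; rewrite ler_nat.
have c0 : 0 < N.+1%:R^-1 :> R by rewrite invr_gt0 ltr0n.
have T0 : [set: 'cV[R]_p] !=set0 by exists 0.
(* Each surrogate inherits the growth bound from the penalized objective below it. *)
have surr_min w : exists x, argmin setT (surrogate f D S rho w) x.
  apply: (coercive_argmin closedT T0 _ c0) => [|x xy].
    exact: surrogate_continuous.
  apply: le_trans (growth rho x Nrho xy) _.
  exact: penalized_le_surrogate.
split.
- apply: (coercive_argmin closedT T0 _ c0) => [|x]; last exact: growth.
  exact: penalized_continuous.
- move=> x0.
  (* By [surr_min] the default 0 is never selected. *)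
  exists (fun n => iter n (fun w => xget 0 (argmin setT (surrogate f D S rho w))) x0).
  by split => // n; apply: xgetPex.
- move=> z x zmin xmm; split => n.
    apply/andP; split; first by rewrite subr_ge0; exact: (zmin.2 (x n.+1) I).
    have := mm_telescope z n S_closed S0 S_convex f_convex rho0 xmm.
    (* The telescoped bound is divided by [n.+1], and its subtracted square is dropped. *)
    rewrite mulrC -ler_pdivlMr ?ltr0n// => /le_trans; apply.
    rewrite ler_pdivrMr ?ltr0n// enorm_sqr.
    have clear_denom (q k : R) : k != 0 -> rho / (2 * k) * q * k = rho / 2 * q.
      by move=> k0; field.
    by rewrite clear_denom ?pnatr_eq0// ler_wpM2l ?divr_ge0// gerBl dot_ge0.
  rewrite -subr_le0.
  apply: le_trans (mm_step (x n) S_closed S0 S_convex f_convex rho0 (xmm n)) _.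
  rewrite mulr_ge0_le0 ?divr_ge0//.
  by rewrite subrr mulmx0 -(scale0r 0) dotZl mul0r sub0r oppr_le0 dot_ge0.
Qed.
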